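(* Let $t\geq 2$ be an integer and let $\mathcal{H}$ be a $t$-partite $t$-uniform hypergraph. Then there exists $\mu>0$ such that $\mathrm{ex}(n,\mathcal{H}^{[t-1]})=O(n^{2-1/t-\mu})$.
   Context: For a graph $F$, $\mathrm{ex}(n,F)$ is the maximum number of edges in a graph on $n$ vertices that does not contain $F$ as a subgraph. For a hypergraph $\mathcal{H}$ and a positive integer $r$, the $r$-fold subdivision $\mathcal{H}^{[r]}$ is the bipartite graph whose two vertex classes are $V(\mathcal{H})$ and $E=E_{1}\cup\dots\cup E_{r}$, where $E_{1},\dots,E_{r}$ are pairwise disjoint copies of the edge set $E(\mathcal{H})$, and an element $e\in E_{i}$ (a copy of a hyperedge) is joined to $v\in V(\mathcal{H})$ by an edge if and only if $v\in e$. A $t$-uniform hypergraph is $t$-partite if its vertex set can be partitioned into $t$ classes so that every hyperedge contains exactly one vertex from each class. *)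

(* Defs.v *)
From HB Require Import structures.
From mathcomp Require Import all_boot all_order all_algebra.
From mathcomp Require Import all_classical all_reals all_analysis.

Set Implicit Arguments.
Unset Strict Implicit.
Unset Printing Implicit Defensive.

(* A finite hypergraph on the vertex type V is given by its edge set
   H : {set {set V}}; a simple graph is a 2-uniform hypergraph. *)
Definition uniform (t : nat) (V : finType) (H : {set {set V}}) : bool :=
  [forall e in H, #|e| == t].

(* The t classes are the fibers of c, some of which may be empty. *)
Definition partite (t : nat) (V : finType) (H : {set {set V}}) : Prop :=
  exists c : V -> 'I_t,
    forall e : {set V}, e \in H ->
      forall i : 'I_t, #|[set v in e | c v == i]| = 1%N.

(* Not necessarily induced copies of F in G. *)
Definition contains_subgraph (U W : finType)
    (F : {set {set U}}) (G : {set {set W}}) : bool :=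
  [exists f : {ffun U -> W},
     injectiveb f && [forall e in F, f @: e \in G]].

(* The value is 0 when no graph on n vertices is F-free, which happens only
   if F is edgeless. *)
Definition ex (n : nat) (U : finType) (F : {set {set U}}) : nat :=
  \max_(G : {set {set 'I_n}} | uniform 2 G && ~~ contains_subgraph F G) #|G|.

(* inr (e, i) is the copy of the hyperedge e in E_i. *)
Definition subdivision_vertex (r : nat) (V : finType) (H : {set {set V}}) :
    finType :=
  (V + {e : {set V} | e \in H} * 'I_r)%type.

Definition subdivision (r : nat) (V : finType) (H : {set {set V}}) :
    {set {set subdivision_vertex r H}} :=
  [set [set (inl p.1 : subdivision_vertex r H); inr p.2]
     | p : V * ({e : {set V} | e \in H} * 'I_r) & p.1 \in val p.2.1].

Lemma subdivision_simple (r : nat) (V : finType) (H : {set {set V}}) :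
  uniform 2 (subdivision r H).
Proof.
by apply/forall_inP => e /imsetP[p _ ->]; rewrite cards2.
Qed.

(* Main.v *)
(* Let n be the number of vertices and let the density of G be n^(-1/t-mu). It
   is enough to find t groups of s vertices such that the transversal t-tuples
   have pairwise disjoint systems of t-1 common neighbours. If half of the edges
   meet vertices of degree at least n^(1-c), the density there is at least n^(-c)
   and a large complete bipartite graph appears. Otherwise count pairs (S, T), S
   a (t-1)-tuple and T a t-tuple completely joined to S: by convexity there are
   n^(t-O(mu)) of them with S injective and N(S) large. If for some such S half of
   the t-tuples T in N(S) have at least K common neighbours, for a large constant
   K, then Erdos' theorem on t-partite t-graphs inside N(S) gives a box whose
   transversals all have K common neighbours, and one chooses greedily. If not,
   n^(t-O(mu)) tuples T have at least t-1 but fewer than K common neighbours, so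
   they contain n^(ts-O(mu)) boxes; a box is bad only if some common neighbour of
   a transversal equals or is adjacent to a further vertex of the box, and as
   degrees are at most n^(1-c) only n^(ts-c) boxes are bad. *)
Require Import Defs.
From HB Require Import structures.
From mathcomp Require Import all_boot all_order all_algebra.
From mathcomp Require Import all_classical all_reals all_analysis.
From mathcomp Require Import zify ring lra.

Set Implicit Arguments.
Unset Strict Implicit.
Unset Printing Implicit Defensive.

Import Order.TTheory GRing.Theory Num.Theory.
Import numFieldNormedType.Exports.

Local Open Scope ring_scope.

(** * Averages over finite types *)

(* Junk value: the average over an empty type is 0. *)
Definition avg (R : realFieldType) (T : finType) (f : T -> R) : R :=
  (\sum_x f x) / #|T|%:R.

Section Average.

Variable R : realFieldType.
Implicit Types T U X Y I J : finType.

Lemma avg_ge0 T (f : T -> R) : (forall x, 0 <= f x) -> 0 <= avg f.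
Proof. by move=> f0; rewrite divr_ge0 ?sumr_ge0. Qed.

Lemma ler_avg T (f g : T -> R) : (forall x, f x <= g x) -> avg f <= avg g.
Proof. by move=> fg; rewrite ler_wpM2r ?invr_ge0 ?ler_sum. Qed.

Lemma eq_avg T (f g : T -> R) : f =1 g -> avg f = avg g.
Proof. by move=> fg; rewrite /avg (eq_bigr g). Qed.

Lemma avg_cst T (a : R) : (0 < #|T|)%N -> avg (fun _ : T => a) = a.
Proof.
move=> T0; rewrite /avg sumr_const -[a *+ _]mulr_natr mulfK //.
by rewrite pnatr_eq0 -lt0n.
Qed.

Lemma avgZ T (a : R) (f : T -> R) : avg (fun x => a * f x) = a * avg f.
Proof. by rewrite /avg -mulr_sumr mulrA. Qed.

Lemma avgD T (f g : T -> R) : avg (fun x => f x + g x) = avg f + avg g.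
Proof. by rewrite /avg big_split mulrDl. Qed.

Lemma avg_sum T I (f : I -> T -> R) :
  avg (fun x => \sum_i f i x) = \sum_i avg (f i).
Proof. by rewrite /avg exchange_big mulr_suml. Qed.

Lemma avg_exchange T U (f : T -> U -> R) :
  avg (fun x => avg (f x)) = avg (fun y => avg (f^~ y)).
Proof.
rewrite /avg -!mulr_suml exchange_big /= -!mulrA; congr (_ * _).
by rewrite mulrC.
Qed.

Lemma sum_avg T (f : T -> R) : (0 < #|T|)%N -> \sum_x f x = #|T|%:R * avg f.
Proof. by move=> T0; rewrite /avg mulrC divfK // pnatr_eq0 -lt0n. Qed.

Lemma avg_set T (A : {set T}) :
  avg (fun x => (x \in A)%:R : R) = #|A|%:R / #|T|%:R.
Proof.
rewrite /avg -sum1_card natr_sum; congr (_ / _).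
by rewrite [RHS]big_mkcond; apply: eq_bigr => x _; case: (x \in A).
Qed.

Lemma exists_of_avg_gt0 T (f : T -> R) : 0 < avg f -> exists x, 0 < f x.
Proof.
move=> f0; apply/existsP; rewrite -[[exists _, _]]negbK negb_exists.
apply/negP => /forallP fle; move: f0; rewrite ltNge mulr_le0_ge0 ?invr_ge0 //.
by apply: sumr_le0 => x _; rewrite leNgt; exact: fle.
Qed.

(** Convexity, by induction: multiplying the bound for [k] by [x] gives more than the next tangent,
    with excess [k.+1 * m ^ k * (x - m) ^ 2], where [k] stands for the exponent below. *)
Lemma expr_ge_tangent (m x : R) k : 0 <= m -> 0 <= x ->
  m ^+ k.+1 + k.+1%:R * m ^+ k * (x - m) <= x ^+ k.+1.
Proof.
move=> m0 x0; elim: k => [|k IH]; first by rewrite !expr1 expr0; lra.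
have := ler_wpM2l x0 IH; rewrite -exprS; apply: le_trans.
rewrite -subr_ge0.
have -> : x * (m ^+ k.+1 + k.+1%:R * m ^+ k * (x - m))
   - (m ^+ k.+2 + k.+2%:R * m ^+ k.+1 * (x - m))
  = k.+1%:R * m ^+ k * (x - m) ^+ 2.
  by rewrite !exprS -[k.+2]addn1 -[k.+1]addn1 !natrD; ring.
apply: mulr_ge0 (sqr_ge0 _); apply: mulr_ge0 => //; exact: exprn_ge0.
Qed.

(** Jensen's inequality: average the tangent at the mean, where the linear term cancels. *)
Lemma avg_pow T (f : T -> R) k : (0 < #|T|)%N -> (forall x, 0 <= f x) ->
  avg f ^+ k <= avg (fun x => f x ^+ k).
Proof.
move=> T0 f0; case: k => [|k]; first by rewrite avg_cst.
set m := avg f; have m0 : 0 <= m by exact: avg_ge0.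
have : avg (fun x => m ^+ k.+1 - k.+1%:R * m ^+ k.+1
         + k.+1%:R * m ^+ k * f x) <= avg (fun x => f x ^+ k.+1).
  apply: ler_avg => x; apply: le_trans (expr_ge_tangent k m0 (f0 x)).
  by rewrite exprS; lra.
by rewrite avgD avgZ avg_cst // -/m exprS; lra.
Qed.

Lemma avg_ffun_prod I T (f : I -> T -> R) :
  avg (fun w : {ffun I -> T} => \prod_i f i (w i)) = \prod_i avg (f i).
Proof.
rewrite /avg big_split /= prodr_const card_ffun natrX -exprVn.
by rewrite bigA_distr_bigA.
Qed.

Lemma card_ffun_gt0 I T : (0 < #|T|)%N -> (0 < #|{ffun I -> T}|)%N.
Proof. by move=> T0; rewrite card_ffun expn_gt0 T0. Qed.

Definition upd I (T : Type) (f : {ffun I -> T}) (i : I) (z : T) : {ffun I -> T} :=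
  [ffun j => if j == i then z else f j].

(* The map [(f, z) |-> (upd f i z, f i)] is an involution. *)
Lemma avg_upd I T (G : {ffun I -> T} -> R) (i : I) : (0 < #|T|)%N ->
  avg (fun f => avg (fun z => G (upd f i z))) = avg G.
Proof.
move=> T0; rewrite [RHS](_ : _ = avg (fun f => avg (fun _ : T => G f))); last first.
  by apply: eq_avg => f; rewrite avg_cst.
rewrite /avg -!mulr_suml; congr (_ / _ / _).
pose h (p : {ffun I -> T} * T) := (upd p.1 i p.2, p.1 i).
have hK : involutive h.
  move=> [f z]; rewrite /h /=; congr pair; last by rewrite ffunE eqxx.
  by apply/ffunP => j; rewrite !ffunE; case: eqP => // ->.
rewrite !pair_big /= [RHS](reindex_inj (inv_inj hK)) /=.
by [].
Qed.

Lemma avg_proj I T (h : T -> R) (i : I) : (0 < #|T|)%N ->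
  avg (fun w : {ffun I -> T} => h (w i)) = avg h.
Proof.
move=> T0; rewrite -(avg_upd _ i) //=.
rewrite -[RHS](@avg_cst {ffun I -> T}) ?card_ffun_gt0 //.
by apply: eq_avg => f; apply: eq_avg => z; rewrite ffunE eqxx.
Qed.

(* By linearity it suffices to treat products of indicators of single values,
   for which both sides factor over [I]. *)
Lemma avg_map I T U (p : T -> U) (c : R) (w : U -> R) (G : {ffun I -> U} -> R) :
  (forall h : U -> R, c * avg (h \o p) = avg (fun u => w u * h u)) ->
  c ^+ #|I| * avg (fun f : {ffun I -> T} => G [ffun i => p (f i)]) =
  avg (fun f : {ffun I -> U} => (\prod_i w (f i)) * G f).
Proof.
move=> hp.
have dec (T' : {ffun I -> U}) : G T' = \sum_T0 G T0 * \prod_i (T' i == T0 i)%:R.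
  rewrite (bigD1 T') //= big1 ?mulr1 => [|i _]; last by rewrite eqxx.
  rewrite big1 ?addr0 // => T0 ne.
  have [i ni] : exists i, T' i != T0 i.
    apply/existsP; rewrite -[[exists _, _]]negbK negb_exists.
    apply: contra ne => /forallP H; apply/eqP/ffunP => i.
    by apply/eqP; rewrite eq_sym; have := H i; rewrite negbK.
  by rewrite (bigD1 i) //= (negbTE ni) mul0r mulr0.
transitivity (\sum_T0 G T0 * \prod_i (c * avg (fun z => (p z == T0 i)%:R))).
  rewrite (eq_avg (fun f => dec _)) avg_sum mulr_sumr.
  apply: eq_bigr => T0 _; rewrite avgZ mulrCA; congr (_ * _).
  rewrite big_split prodr_const /= -[in RHS]avg_ffun_prod; congr (_ * _).
  by apply: eq_avg => f; apply: eq_bigr => i _; rewrite ffunE.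
transitivity (avg (fun f : {ffun I -> U} =>
    \sum_T0 G T0 * \prod_i (w (f i) * (f i == T0 i)%:R))).
  rewrite avg_sum; apply: eq_bigr => T0 _; rewrite avgZ; congr (_ * _).
  rewrite (avg_ffun_prod (fun i u => w u * (u == T0 i)%:R)).
  by apply: eq_bigr => i _; exact: (hp (fun u => (u == T0 i)%:R)).
apply: eq_avg => f; rewrite [in RHS]dec mulr_sumr; apply: eq_bigr => T0 _.
by rewrite big_split mulrCA.
Qed.

Lemma prod_indicator I (P : pred I) :
  \prod_i (P i)%:R = [forall i, P i]%:R :> R.
Proof.
case: forallP => [H|H]; first by rewrite big1 // => i _; rewrite H.
have [i ni] : exists i, ~~ P i.
  apply/existsP; rewrite -[[exists _, _]]negbK negb_exists.
  by apply/negP => /forallP G; apply: H => i; have := G i; rewrite negbK.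
by rewrite (bigD1 i) //= (negbTE ni) mul0r.
Qed.

Lemma avg_ffun_in I T (A : {set T}) :
  avg (fun f : {ffun I -> T} => [forall i, f i \in A]%:R : R) =
  (#|A|%:R / #|T|%:R) ^+ #|I|.
Proof.
rewrite -(eq_avg (fun f => prod_indicator _)).
by rewrite (avg_ffun_prod (fun _ x => (x \in A)%:R)) prodr_const avg_set.
Qed.

(** The density stays a factor on the left so that an empty [A] is covered, both sides being [0]. *)
Lemma avg_subset T (A : {set T}) (h : T -> R) :
  #|A|%:R / #|T|%:R * avg (fun x : {x | x \in A} => h (val x)) =
  avg (fun x => (x \in A)%:R * h x).
Proof.
have e : \sum_(x : {x | x \in A}) h (val x) = \sum_x (x \in A)%:R * h x.
  rewrite -(big_sub (mem A) h).
  by rewrite big_mkcond; apply: eq_bigr => x _; case: (x \in A); rewrite ?mul1r ?mul0r.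
rewrite /avg e card_sig; have [A0|A0] := eqVneq #|A| 0%N; last first.
  by rewrite mulrAC [_ * (_ * _)]mulrCA divff ?mulr1 // pnatr_eq0.
rewrite A0 !mul0r big1 ?mul0r // => x _.
by rewrite (card0_eq A0) mul0r.
Qed.

Lemma avg_ffun_subset I T (A : {set T}) (G : {ffun I -> T} -> R) :
  (#|A|%:R / #|T|%:R) ^+ #|I| *
    avg (fun f : {ffun I -> {x | x \in A}} => G [ffun i => val (f i)]) =
  avg (fun f : {ffun I -> T} => [forall i, f i \in A]%:R * G f).
Proof.
rewrite (@avg_map _ _ _ val _ (fun x => (x \in A)%:R)); last exact: avg_subset.
by apply: eq_avg => f; rewrite prod_indicator.
Qed.

(** Union bound over the [k * k] ordered pairs of positions: when one of two distinct positions is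
    resampled, it hits the value at the other with probability [1 / #|T|]. *)
Lemma avg_noninjective k T : (0 < #|T|)%N ->
  avg (fun S : {ffun 'I_k -> T} => (~~ injectiveb S)%:R : R)
    <= (k * k)%:R / #|T|%:R.
Proof.
move=> T0.
pose bad (p : 'I_k * 'I_k) (S : {ffun 'I_k -> T}) : R :=
  ((p.1 != p.2) && (S p.1 == S p.2))%:R.
apply: (@le_trans _ _ (avg (fun S => \sum_p bad p S))).
  apply: ler_avg => S; case: injectiveP => [_|nS] /=.
    by apply: sumr_ge0 => p _; rewrite /bad.
  have [p hp] : exists p : 'I_k * 'I_k, (p.1 != p.2) && (S p.1 == S p.2).
    apply/existsP; rewrite -[[exists _, _]]negbK negb_exists.
    apply/negP => /forallP H; apply: nS => a b ab.
    by have := H (a, b); rewrite /= ab eqxx andbT negbK => /eqP.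
  rewrite (bigD1 p) //= {1}/bad hp lerDl.
  by apply: sumr_ge0 => p' _; rewrite /bad.
rewrite avg_sum.
have le1 p : avg (bad p) <= #|T|%:R^-1.
  rewrite /bad; case: (eqVneq p.1 p.2) => [e|ne] /=.
    by rewrite avg_cst ?card_ffun_gt0 ?invr_ge0.
  rewrite -(avg_upd _ p.1) //.
  rewrite -[leRHS](@avg_cst {ffun 'I_k -> T}) ?card_ffun_gt0 //.
  apply: ler_avg => S; rewrite /avg.
  rewrite (eq_bigr (fun z => (z == S p.2)%:R)); last first.
    by move=> z _; rewrite !ffunE eqxx [p.2 == _]eq_sym (negbTE ne).
  rewrite (bigD1 (S p.2)) //= eqxx big1 ?addr0 ?mul1r //.
  by move=> z /negbTE ->.
apply: le_trans (ler_sum _ (fun p _ => le1 p)) _.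
by rewrite sumr_const card_prod card_ord -[leLHS]mulr_natl.
Qed.

(* Double counting of the stars centred in [Y], then convexity of the [k]-th
   power applied to the degrees of the vertices of [Y]. *)
Lemma avg_codegree (X Y : finType) (r : X -> Y -> bool) k :
  (0 < #|X|)%N -> (0 < #|Y|)%N ->
  #|Y|%:R * avg (fun x => avg (fun y => (r x y)%:R : R)) ^+ k <=
  avg (fun S : {ffun 'I_k -> X} => #|[set y | [forall i, r (S i) y]]|%:R : R).
Proof.
move=> X0 Y0; rewrite [in leLHS]avg_exchange.
have e (S : {ffun 'I_k -> X}) : #|[set y | [forall i, r (S i) y]]|%:R =
   #|Y|%:R * avg (fun y => \prod_i (r (S i) y)%:R) :> R.
  rewrite -sum_avg // -sum1_card natr_sum big_mkcond; apply: eq_bigr => y _.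
  by rewrite inE prod_indicator; case: [forall _, _].
rewrite (eq_avg e) avgZ ler_wpM2l // [leRHS]avg_exchange.
rewrite -[leRHS](_ : avg (fun y => avg (fun x => (r x y)%:R : R) ^+ k) = _).
  by apply: avg_pow => // y; exact: avg_ge0.
apply: eq_avg => y.
by rewrite (avg_ffun_prod (fun _ x => (r x y)%:R)) prodr_const card_ord.
Qed.

End Average.

(** * Boxes in dense families of tuples *)

Section Boxes.

Variables (R : realFieldType) (t s : nat) (Y : finType).

Notation row := {ffun 'I_s.+1 -> Y}.
Notation box := {ffun 'I_t -> row}.

Definition transversal (y : box) (f : {ffun 'I_t -> 'I_s.+1}) :
  {ffun 'I_t -> Y} := [ffun i => y i (f i)].

(* [boxes F l y] says that every transversal of [y] leaving column [0] only in
   the rows of [l] satisfies [F]; rows are released one at a time. *)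
Fixpoint boxes (F : {ffun 'I_t -> Y} -> bool) (l : seq 'I_t) (y : box) : bool :=
  if l is i :: l' then [forall j, boxes F l' (upd y i [ffun=> y i j])]
  else F [ffun i => y i ord0].

Lemma boxes_transversal F l y (f : {ffun 'I_t -> 'I_s.+1}) : boxes F l y ->
  F [ffun i => y i (if i \in l then f i else ord0)].
Proof.
elim: l y => [|i l IH] y //=.
move=> /forallP/(_ (f i))/IH; congr (is_true (F _)); apply/ffunP => a.
rewrite !ffunE inE; case: eqP => [->|_] //=.
by rewrite ffunE.
Qed.

Lemma eq_boxes F l (y y' : box) : (forall i, i \in l -> y i = y' i) ->
  (forall i, y i ord0 = y' i ord0) -> boxes F l y = boxes F l y'.
Proof.
elim: l y y' => [|i l IH] y y' el e0 /=.
  by congr F; apply/ffunP => a; rewrite !ffunE.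
apply: eq_forallb => j; apply: IH => a; rewrite ?ffunE.
  by case: eqP => [_ _|_ al]; rewrite el // inE ?eqxx // al orbT.
by case: eqP => // _; rewrite !ffunE el // inE eqxx.
Qed.

Lemma upd_upd (I : finType) (T : Type) (f : {ffun I -> T}) i z z' :
  upd (upd f i z) i z' = upd f i z'.
Proof. by apply/ffunP => j; rewrite !ffunE; case: eqP. Qed.

Lemma upd_same (I : finType) (T : Type) (f : {ffun I -> T}) i z :
  upd f i z i = z.
Proof. by rewrite ffunE eqxx. Qed.

(* Releasing a row raises the density to the power [s.+1], by convexity. *)
Lemma avg_boxes (F : {ffun 'I_t -> Y} -> bool) l : uniq l -> (0 < #|Y|)%N ->
  avg (fun T => (F T)%:R : R) ^+ (s.+1 ^ size l) <=
  avg (fun y => (boxes F l y)%:R : R).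
Proof.
move=> + Y0; have row0 : (0 < #|{: row}|)%N by exact: card_ffun_gt0.
elim: l => [_|i l IH /=/andP[il ul]].
  have := @avg_map _ _ row _ (fun w => w ord0) 1 (fun=> 1) (fun T => (F T)%:R : R).
  rewrite expr1n mul1r => -> => [|h].
    by rewrite expn0 expr1; apply: ler_avg => T; rewrite big1 // mul1r.
  by rewrite mul1r (avg_proj h ord0) //; apply: eq_avg => u; rewrite mul1r.
pose h y z : R := (boxes F l (upd y i [ffun=> z]))%:R.
have h0 y z : 0 <= h y z by [].
(* A row outside [l] is read only in column [0], so it may be made constant. *)
have e1 : avg (fun y => (boxes F l y)%:R : R) = avg (fun y => avg (h y)).
  rewrite -[LHS](avg_upd _ i) //; apply: eq_avg => y.
  rewrite -[RHS](avg_proj _ (ord0 : 'I_s.+1)) //; apply: eq_avg => w.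
  rewrite /h; congr (_%:R); congr nat_of_bool.
  apply: eq_boxes => a; first move=> al; rewrite !ffunE; case: eqP => // e.
    by rewrite -e al in il.
  by rewrite ffunE.
(* With row [i] released, the same event is required of each of its [s.+1] independent entries. *)
have e2 : avg (fun y => (boxes F (i :: l) y)%:R : R) =
    avg (fun y => avg (h y) ^+ s.+1).
  rewrite -[LHS](avg_upd _ i) //; apply: eq_avg => y.
  rewrite -[in RHS](card_ord s.+1) -prodr_const -avg_ffun_prod.
  apply: eq_avg => w /=.
  rewrite (eq_forallb (fun j => congr1 _ (upd_upd _ _ _ _))).
  rewrite [RHS]prod_indicator; congr (_%:R); congr nat_of_bool.
  by apply: eq_forallb => j; rewrite upd_same.
rewrite e2; apply: le_trans (avg_pow _ _ _) => //; last first.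
- by move=> y; exact: avg_ge0.
- by rewrite card_ffun_gt0.
rewrite -e1 expnSr exprM lerXn2r ?IH // nnegrE ?exprn_ge0 ?avg_ge0 //.
Qed.

(** As [f i != j], the transversal does not read entry [(i, j)], which can be resampled while the
    forbidden set stays fixed. *)
Lemma avg_bad_entry (F : {ffun 'I_t -> Y} -> bool)
    (B : {ffun 'I_t -> Y} -> {set Y})
    (b : R) (f : {ffun 'I_t -> 'I_s.+1}) (i : 'I_t) (j : 'I_s.+1) :
  (0 < #|Y|)%N -> 0 <= b -> (forall T, F T -> #|B T|%:R <= b) -> f i != j ->
  avg (fun y : box => (F (transversal y f) &&
                       (y i j \in B (transversal y f)))%:R : R) <= b / #|Y|%:R.
Proof.
move=> Y0 b0 Bb fij; have row0 : (0 < #|{: row}|)%N by exact: card_ffun_gt0.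
rewrite -[leLHS](avg_upd _ i) // -[leRHS](@avg_cst _ box) ?card_ffun_gt0 //.
apply: ler_avg => y; rewrite -[leLHS](avg_upd _ j) //.
rewrite -[leRHS](@avg_cst _ row) //; apply: ler_avg => w.
pose T := transversal (upd y i w) f.
have eT z : transversal (upd y i (upd w j z)) f = T.
  apply/ffunP => a; rewrite !ffunE; case: eqP => // ->.
  by rewrite ffunE (negbTE fij).
rewrite (eq_avg (g := fun z => (F T && (z \in B T))%:R)); last first.
  by move=> z; rewrite eT !upd_same.
case FT: (F T) => /=; last by rewrite avg_cst // divr_ge0.
by rewrite avg_set ler_wpM2r ?invr_ge0 // Bb.
Qed.

(** First moment argument: the density of boxes given by [avg_boxes] exceeds the expected number of
    bad triples [(f, (i, j))], of which there are at most [s.+1 ^ t * (t * s.+1)]. *)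
Lemma box_avoiding (F : {ffun 'I_t -> Y} -> bool)
    (B : {ffun 'I_t -> Y} -> {set Y})
    (b : R) : (0 < #|Y|)%N -> 0 <= b ->
  (forall T, F T -> #|B T|%:R <= b) ->
  (s.+1 ^ t * (t * s.+1))%:R * (b / #|Y|%:R) <
    avg (fun T => (F T)%:R : R) ^+ (s.+1 ^ t) ->
  exists y : box, (forall f, F (transversal y f)) /\
    (forall (f : {ffun 'I_t -> 'I_s.+1}) i j,
       f i != j -> y i j \notin B (transversal y f)).
Proof.
move=> Y0 b0 Bb many.
pose bad (p : {ffun 'I_t -> 'I_s.+1} * ('I_t * 'I_s.+1)) (y : box) :=
  [&& p.1 p.2.1 != p.2.2, F (transversal y p.1)
    & y p.2.1 p.2.2 \in B (transversal y p.1)].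
pose g y : R := (boxes F (enum 'I_t) y)%:R + (-1) * \sum_p (bad p y)%:R.
have : 0 < avg g.
  rewrite avgD avgZ avg_sum mulN1r subr_gt0.
  have := avg_boxes F (enum_uniq 'I_t) Y0; rewrite -cardE card_ord.
  apply: lt_le_trans; apply: le_lt_trans many.
  have le1 p : avg (fun y => (bad p y)%:R : R) <= b / #|Y|%:R.
    case: p => f [i j]; rewrite /bad /=.
    case: (boolP (f i != j)) => [fij|_]; first exact: avg_bad_entry.
    by rewrite /= avg_cst ?divr_ge0 // !card_ffun_gt0.
  apply: le_trans (ler_sum _ (fun p _ => le1 p)) _.
  rewrite sumr_const !card_prod card_ffun !card_ord.
  by rewrite -[leLHS]mulr_natl.
case/exists_of_avg_gt0 => y; rewrite /g => gy; exists y.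
have bxy : boxes F (enum 'I_t) y.
  move: gy; case: boxes => //; rewrite add0r mulN1r oppr_gt0 ltNge sumr_ge0 //.
have Fy f : F (transversal y f).
  have := boxes_transversal f bxy; congr (is_true (F _)).
  by apply/ffunP => a; rewrite !ffunE mem_enum.
split=> // f i j fij; apply/negP => yB; move: gy.
rewrite bxy (bigD1 (f, (i, j))) //= {1}/bad /= fij Fy yB /=.
by rewrite mulN1r opprD addrA subrr add0r oppr_gt0 ltNge sumr_ge0.
Qed.

End Boxes.

(** If two positions held the same vertex, a transversal through the first and avoiding the second
    would put it both inside and outside [B]. Such a transversal exists because there are at least
    two columns. *)
Lemma box_injective (t s : nat) (Y : finType)
    (y : {ffun 'I_t -> {ffun 'I_s.+2 -> Y}}) (B : {ffun 'I_t -> Y} -> {set Y}) :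
  (forall f i, transversal y f i \in B (transversal y f)) ->
  (forall (f : {ffun 'I_t -> 'I_s.+2}) i j,
     f i != j -> y i j \notin B (transversal y f)) ->
  injective (fun p : 'I_t * 'I_s.+2 => y p.1 p.2).
Proof.
move=> inB ninB [i j] [i' j'] /= e; apply/eqP; apply: contraT => ne.
have [f fij fij'] : exists2 f : {ffun 'I_t -> 'I_s.+2}, f i = j & f i' != j'.
  have [ei|nei] := eqVneq i i'.
    exists [ffun => j]; rewrite !ffunE //; apply: contraNneq ne => <-.
    by rewrite ei.
  have [z zj'] : exists z : 'I_s.+2, z != j'.
    by have [->|] := eqVneq j' ord0; [exists ord_max | rewrite eq_sym; exists ord0].
  by exists [ffun a => if a == i then j else z]; rewrite ffunE ?eqxx //
    [i' == i]eq_sym (negbTE nei).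
have := ninB f i' j' fij'; rewrite -e -fij.
by have := inB f i; rewrite {1}/transversal ffunE => ->.
Qed.

(* A complete [t]-partite [t]-uniform hypergraph with parts of size [s],
   subdivided [m] times; [f] lists the columns of a hyperedge. *)
Definition subdivided_box (W : finType) (adj : rel W) (t s m : nat) : Prop :=
  exists (y : 'I_t * 'I_s -> W) (g : {ffun 'I_t -> 'I_s} * 'I_m -> W),
    [/\ injective y, injective g, forall p q, y p != g q
      & forall (f : {ffun 'I_t -> 'I_s}) k i, adj (y (i, f i)) (g (f, k))].

(** * Greedy selection and embedding of the subdivision *)

(** Greedy choice: at each step fewer than [#|Z|] values are already used, so together with [C] they
    cannot exhaust [A z]. *)
Lemma distinct_representatives (Z W : finType) (A : Z -> {set W}) (C : {set W}) :
  (forall z, #|Z| + #|C| <= #|A z|)%N ->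
  exists g : Z -> W, injective g /\ forall z, g z \in A z :\: C.
Proof.
move=> big.
have step (D : {set W}) z : (#|D| < #|Z| + #|C|)%N -> exists x, x \in A z :\: D.
  move=> Dlt; apply/set0Pn; rewrite -card_gt0 cardsD subn_gt0.
  apply: leq_trans (leq_trans Dlt (big z)).
  by rewrite ltnS subset_leq_card // subsetIr.
have [g0 _] : exists g0 : Z -> W, True.
  have [g0 _] : {g0 : Z -> W & forall z, g0 z \in A z :\: C}.
    apply: (@choice _ _ (fun z x => x \in A z :\: C)) => z; apply: step.
    by rewrite -{1}[#|C|]add0n ltn_add2r; apply/card_gt0P; exists z.
  by exists g0.
suff [g [gi gA]] : exists g : Z -> W, {in enum Z &, injective g} /\
    forall z, z \in enum Z -> g z \in A z :\: C.
  exists g; split; first by move=> a b; apply: gi; rewrite mem_enum.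
  by move=> z; apply: gA; rewrite mem_enum.
have : uniq (enum Z) by exact: enum_uniq.
have : (size (enum Z) <= #|Z|)%N by rewrite -cardE.
elim: (enum Z) => [_ _|z l IH /= sl /andP[zl ul]]; first by exists g0.
have [g [gi gA]] := IH (ltnW sl) ul.
have [|x] := step (C :|: [set x in map g l]) z.
  rewrite addnC (leq_ltn_trans (leq_card_setU _ _)) // ltn_add2l.
  by rewrite (leq_ltn_trans _ sl) // cardsE (leq_trans (card_size _)) ?size_map.
rewrite !inE negb_or => /andP[/andP[xC xl] xA].
exists (fun a => if a == z then x else g a); split.
  move=> a b; rewrite !inE.
  have ng c : c \in l -> g c <> x by move=> cl e; rewrite -e map_f in xl.
  case: (eqVneq a z) => [->|az] /=; case: (eqVneq b z) => [->|bz] //= al bl.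
  - by move=> /esym/(ng _ bl).
  - by move=> /(ng _ al).
  - exact: gi.
move=> a; rewrite inE; case: eqP => [-> _|_ /=]; first by rewrite inE xC.
exact: gA.
Qed.

(** Here [s ^ t * m] counts the common neighbours to be chosen and [t * s] the vertices of the box
    to be avoided. *)
Lemma subdivided_box_greedy (W : finType) (adj : rel W) (t s m : nat)
    (y : 'I_t * 'I_s -> W) : injective y ->
  (forall f : {ffun 'I_t -> 'I_s},
     s ^ t * m + t * s <= #|[set x | [forall i, adj (y (i, f i)) x]]|)%N ->
  subdivided_box adj t s m.
Proof.
move=> yi big.
have [] := @distinct_representatives
   ({ffun 'I_t -> 'I_s} * 'I_m)%type W
   (fun p => [set x | [forall i, adj (y (i, p.1 i)) x]])
   [set y p | p : 'I_t * 'I_s].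
  move=> [f k] /=; apply: leq_trans (big f).
  by rewrite card_prod card_ffun !card_ord card_imset // card_prod !card_ord.
move=> g [gi gA]; exists y, g; split=> //.
- move=> p q; have := gA q; rewrite inE => /andP[+ _].
  by apply: contraNneq => <-; rewrite imset_f.
- move=> f k i; have := gA (f, k); rewrite !inE => /andP[_].
  by move=> /forallP.
Qed.

(** A vertex goes to the row of its class and the column of its rank in [V]; a hyperedge goes to the
    transversal through its vertices, from which it can be recovered. *)
Lemma subdivided_box_contains (t s : nat) (V W : finType) (H : {set {set V}})
    (G : {set {set W}}) (m : nat) : partite t H -> (#|V| <= s.+1)%N ->
  subdivided_box (fun x z => [set x; z] \in G) t s.+1 m ->
  contains_subgraph (subdivision m H) G.
Proof.
move=> [c cH] Vs [y [g [yi gi yg adjyg]]].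
pose rk (v : V) : 'I_s.+1 := widen_ord Vs (enum_rank v).
have rki : injective rk by move=> a b /(congr1 val)/= e; apply/enum_rank_inj/val_inj.
pose vtx (e : {e : {set V} | e \in H}) (i : 'I_t) : option V :=
  [pick v in [set v in val e | c v == i]].
(* The default [ord0] is never taken, since a hyperedge meets every class. *)
pose tau (e : {e : {set V} | e \in H}) : {ffun 'I_t -> 'I_s.+1} :=
  [ffun i => if vtx e i is Some v then rk v else ord0].
have tauE (e : {e : {set V} | e \in H}) v : (v \in val e) = (tau e (c v) == rk v).
  rewrite ffunE /vtx; case: e => e eH /=.
  have /eqP/cards1P[w ew] := cH _ eH (c v).
  case: pickP => [u|]; rewrite ew; last by move/(_ w); rewrite inE eqxx.
  rewrite inE => /eqP ->; rewrite (inj_eq rki) eq_sym.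
  by move/setP: ew => /(_ v); rewrite !inE eqxx andbT.
have taui : injective tau.
  move=> e e' ee; apply: val_inj; apply/setP => v.
  by rewrite !tauE ee.
pose h (u : subdivision_vertex m H) : W :=
  match u with inl v => y (c v, rk v) | inr p => g (tau p.1, p.2) end.
apply/existsP; exists [ffun u => h u]; apply/andP; split.
  apply/injectiveP => -[v|[e k]] [v'|[e' k']]; rewrite !ffunE /=.
  - by move=> /yi/(congr1 snd)/rki ->.
  - by move=> /eqP; rewrite (negbTE (yg _ _)).
  - by move=> /esym/eqP; rewrite (negbTE (yg _ _)).
  - by move=> /gi e2; rewrite (taui _ _ (congr1 fst e2)) (congr1 snd e2 : k = k').
apply/forall_inP => _ /imsetP[[v [e k]] /= ve ->].
rewrite imsetU1 imset_set1 !ffunE /=.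
have {}ve : tau e (c v) == rk v by rewrite -tauE; move: ve; rewrite inE.
by have := adjyg (tau e) k (c v); rewrite (eqP ve).
Qed.

(** * Common neighbourhoods in a graph *)

Section CommonNeighbourhoods.

Variable R : realFieldType.

(** A random [(t * s)]-tuple of [X] has many common neighbours on average, even after the
    non-injective tuples are discounted. Some injective tuple thus gives a complete bipartite graph,
    in which any arrangement into a box works. *)
Lemma subdivided_box_of_dense_part (X W : finType) (p : X -> W) (adj : rel W)
    (t s m : nat) : injective p -> (0 < #|X|)%N -> (0 < #|W|)%N ->
  #|W|%:R * ((t * s * (t * s))%:R / #|X|%:R) + (s ^ t * m + t * s)%:R <
    #|W|%:R * avg (fun x => avg (fun z => (adj (p x) z)%:R : R)) ^+ (t * s) ->
  subdivided_box adj t s m.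
Proof.
move=> pi X0 W0 dense; set K := (s ^ t * m + t * s)%N in dense *.
pose cn (S : {ffun 'I_(t * s) -> X}) :=
  [set z | [forall i, adj (p (S i)) z]].
pose g S : R := #|cn S|%:R + (-1) * (#|W|%:R * (~~ injectiveb S)%:R) + - K%:R.
have : 0 < avg g.
  rewrite !avgD avgZ avgZ avg_cst ?card_ffun_gt0 // mulN1r -addrA -opprD subr_gt0.
  have := @avg_codegree R _ _ (fun x z => adj (p x) z) (t * s) X0 W0.
  apply: lt_le_trans.
  apply: (le_lt_trans _ dense); rewrite lerD2r ler_wpM2l //.
  exact: avg_noninjective.
case/exists_of_avg_gt0 => S; rewrite /g => gS.
have Si : injective S.
  apply/injectiveP; move: gS; apply: contraTT => /negbTE -> /=.
  rewrite mulr1 mulN1r -leNgt -addrA -opprD subr_le0.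
  by rewrite ler_wpDr ?ler_nat ?max_card.
have Kcn : (K <= #|cn S|)%N.
  rewrite -(ler_nat R); move/injectiveP: Si gS => -> /=.
  by rewrite mulr0 mulr0 addr0 subr_gt0 => /ltW.
have cI : #|{: 'I_t * 'I_s}| = (t * s)%N by rewrite card_prod !card_ord.
apply: (@subdivided_box_greedy _ adj t s m
  (fun q => p (S (cast_ord cI (enum_rank q))))).
  by move=> a b /pi/Si/cast_ord_inj/enum_rank_inj.
move=> f; apply: leq_trans Kcn (subset_leq_card _).
apply/fintype.subsetP => z; rewrite !inE => /forallP H.
by apply/forallP => i; exact: H.
Qed.

Variables (W : finType) (adj r : rel W).
Hypothesis adj_sym : symmetric adj.
Hypothesis adj_irr : irreflexive adj.
Hypothesis r_adj : subrel r adj.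

(** [r] need not be symmetric: it will be adjacency restricted to first arguments of low degree, so
    the common neighbours counted here have low degree. *)
Definition common (t : nat) (T : {ffun 'I_t -> W}) : {set W} :=
  [set x | [forall i, r x (T i)]].

(** The forbidden set of a transversal is its own set of entries, which only forces the box to be
    injective; the common neighbours are then chosen greedily. *)
Lemma subdivided_box_of_popular (t s m : nat) (D : {set W}) :
  (0 < #|D|)%N ->
  (s.+2 ^ t * (t * s.+2))%:R * (t%:R / #|D|%:R) <
   avg (fun T : {ffun 'I_t -> {x | x \in D}} =>
      (s.+2 ^ t * m + t * s.+2 <= #|common [ffun i => val (T i)]|)%N%:R : R)
     ^+ (s.+2 ^ t) ->
  subdivided_box adj t s.+2 m.
Proof.
move=> D0; have cD : #|{: {x | x \in D}}| = #|D| by rewrite card_sig.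
rewrite -cD in D0 * => many.
pose B (T : {ffun 'I_t -> {x | x \in D}}) := [set T i | i : 'I_t].
have Bb T : #|B T|%:R <= t%:R :> R.
  by rewrite ler_nat (leq_trans (leq_imset_card _ _)) // card_ord.
have [y [Fy yB]] := box_avoiding D0 (ler0n R t) (fun T _ => Bb T) many.
have yi := box_injective (fun f i => imset_f (transversal y f) (erefl (i \in 'I_t))) yB.
apply: (@subdivided_box_greedy _ adj t s.+2 m (fun q => val (y q.1 q.2))).
  by move=> a b /val_inj/yi.
move=> f; apply: leq_trans (Fy f) (subset_leq_card _).
apply/fintype.subsetP => x; rewrite !inE => /forallP H; apply/forallP => i.
by have := H i; rewrite !ffunE adj_sym => /r_adj.
Qed.

(* If [x] were chosen for two transversals, or were itself an entry of the box,
   some entry would lie in the union of the closed neighbourhoods of the common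
   neighbours of a transversal avoiding that entry; this union is small. *)
Lemma subdivided_box_of_unpopular (t s m K : nat) (Delta : R) :
  (0 < #|W|)%N -> (0 < t)%N -> (0 < m)%N -> 0 <= Delta ->
  (forall x z, r x z -> #|[set z | adj x z]|%:R <= Delta) ->
  (s.+2 ^ t * (t * s.+2))%:R * (K%:R * (Delta + 1) / #|W|%:R) <
   avg (fun T : {ffun 'I_t -> W} => (m <= #|common T| < K)%N%:R : R)
     ^+ (s.+2 ^ t) ->
  subdivided_box adj t s.+2 m.
Proof.
move=> W0 t0 m0 Delta0 degr many.
pose B (T : {ffun 'I_t -> W}) :=
  \bigcup_(x in common T) (x |: [set z | adj x z]).
pose F (T : {ffun 'I_t -> W}) := (m <= #|common T| < K)%N.
(* Fewer than [K] common neighbours, each with a closed neighbourhood of size at most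
   [Delta + 1]. *)
have Bb T : F T -> #|B T|%:R <= K%:R * (Delta + 1).
  case/andP => _ TK.
  apply: (@le_trans _ _ (\sum_(x in common T) (Delta + 1))).
    apply: (@le_trans _ _ (\sum_(x in common T) #|x |: [set z | adj x z]|%:R)).
      rewrite -natr_sum ler_nat /B.
      elim/big_rec2: _ => [|x A N _ IH]; first by rewrite cards0.
      by rewrite (leq_trans (leq_card_setU _ _)) // leq_add2l.
    apply: ler_sum => x; rewrite inE => /forallP/(_ (Ordinal t0))/degr dx.
    rewrite cardsU1 natrD addrC lerD // inE adj_irr.
    by [].
  rewrite sumr_const -[leLHS]mulr_natl ler_wpM2r ?addr_ge0 //.
  by rewrite ler_nat ltnW.
have [|y [Fy yB]] := box_avoiding W0 _ Bb many.
  by rewrite mulr_ge0 ?addr_ge0.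
have inB f i : transversal y f i \in B (transversal y f).
  have /andP[mT _] := Fy f.
  have /card_gt0P[x xT] := leq_trans m0 mT.
  apply/bigcupP; exists x => //; rewrite !inE.
  by move: xT; rewrite inE => /forallP/(_ i)/r_adj ->; rewrite orbT.
have yi := box_injective inB yB.
pose g (q : {ffun 'I_t -> 'I_s.+2} * 'I_m) : W :=
  enum_val (widen_ord (proj1 (andP (Fy q.1))) q.2).
have gin q : g q \in common (transversal y q.1) by exact: enum_valP.
have gadj q i : adj (g q) (y i (q.1 i)).
  have := gin q; rewrite inE => /forallP/(_ i)/r_adj.
  by rewrite ffunE.
exists (fun q => y q.1 q.2), g; split.
- exact: yi.
- move=> [f k] [f' k'] e.
  have ff' : f = f'.
    apply/ffunP => i; apply/eqP; apply: contraT => nf.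
    have /bigcupP[] := yB f i (f' i) nf; exists (g (f, k)); first exact: (gin (f, k)).
    by rewrite !inE {2}e (gadj (f', k') i) orbT.
  move: e; rewrite -ff' => /enum_val_inj /(congr1 val) /= kk'.
  by congr (_, _); apply: val_inj.
- move=> [i j] [f k] /=; apply/eqP => e.
  have [fij|fij] := eqVneq (f i) j.
    by have := gadj (f, k) i; rewrite /= fij e adj_irr.
  have /bigcupP[] := yB f i j fij; exists (g (f, k)); first exact: (gin (f, k)).
  by rewrite !inE e eqxx.
- by move=> f k i; rewrite adj_sym; exact: (gadj (f, k) i).
Qed.

(* Count the pairs [(S, T)] with [S] an injective [k]-tuple having at least
   [Theta] common neighbours and [T] a [k.+1]-tuple of these. By convexity there
   are many such pairs; at least half of them have [T] with fewer than [K] common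
   neighbours; and each such [T] lies in at most [K ^ k] pairs. *)
Lemma avg_unpopular (k K Theta : nat) (w : R) :
  (0 < #|W|)%N -> (0 < Theta)%N -> 0 <= w ->
  w + (k * k)%:R + Theta%:R <=
    #|W|%:R * avg (fun x => avg (fun z => (r x z)%:R : R)) ^+ k ->
  (forall D : {set W}, (Theta <= #|D|)%N ->
     avg (fun T : {ffun 'I_k.+1 -> {x | x \in D}} =>
       (K <= #|common [ffun i => val (T i)]|)%N%:R : R) <= 2^-1) ->
  (w / #|W|%:R) ^+ k.+1 / 2 <=
   avg (fun T : {ffun 'I_k.+1 -> W} => (k <= #|common T| < K)%N%:R : R)
     * (K%:R / #|W|%:R) ^+ k.
Proof.
move=> W0 Theta0 w0 wle unpop; set n : R := #|W|%:R.
have n0 : 0 < n by rewrite ltr0n.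
pose nb (S : {ffun 'I_k -> W}) := [set z | [forall i, r (S i) z]].
pose good (S : {ffun 'I_k -> W}) := injectiveb S && (Theta <= #|nb S|)%N.
pose d (S : {ffun 'I_k -> W}) : R := (good S)%:R * #|nb S|%:R.
have d0 S : 0 <= d S by rewrite mulr_ge0.
(* Non-injective tuples account for [k * k] of the average codegree, and tuples with small
   neighbourhoods for [Theta]. *)
have wd : w <= avg d.
  rewrite -(lerD2r ((k * k)%:R + Theta%:R)) addrA (le_trans wle) //.
  have := @avg_codegree R _ _ r k W0 W0; move/le_trans; apply.
  apply: (@le_trans _ _ (avg (fun S => d S +
      (n * (~~ injectiveb S)%:R + Theta%:R)))).
    apply: ler_avg => S; rewrite -/(nb S) /d /good.
    case: injectiveP => _ /=; last first.
      by rewrite mul0r add0r mulr1 ler_wpDr ?ler_nat ?max_card.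
    rewrite mulr0 add0r; case: leqP => h /=; rewrite ?mul1r ?mul0r ?lerDl //.
    by rewrite add0r ler_nat ltnW.
  rewrite !avgD lerD2l avgZ avg_cst ?card_ffun_gt0 // lerD2r.
  by rewrite mulrC -ler_pdivlMr // avg_noninjective.
pose Q (T : {ffun 'I_k.+1 -> W}) : R := (#|common T| < K)%N%:R.
have step1 S : (d S / n) ^+ k.+1 / 2 <=
    avg (fun T : {ffun 'I_k.+1 -> W} => (good S && [forall i, T i \in nb S])%:R * Q T).
  rewrite /d; case: (boolP (good S)) => [gS|_] /=; last first.
    by rewrite mul0r mul0r expr0n mul0r avg_ge0 // => T; rewrite mul0r.
  rewrite mul1r -avg_ffun_subset card_ord ler_wpM2l ?exprn_ge0 ?divr_ge0 //.
  have /andP[_ ThS] := gS.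
  have cD : (0 < #|{: {x | x \in nb S}}|)%N.
    by rewrite card_sig (leq_trans Theta0).
  have := unpop _ ThS; set pop := avg _ => pop2.
  have : pop + avg (fun T : {ffun 'I_k.+1 -> {x | x \in nb S}} =>
      Q [ffun i => val (T i)]) = 1.
    rewrite -avgD -[RHS](@avg_cst R {ffun 'I_k.+1 -> {x | x \in nb S}}).
      by apply: eq_avg => T; rewrite /Q; case: leqP; rewrite ?addr0 ?add0r.
    exact: card_ffun_gt0.
  by lra.
have step2 : (w / n) ^+ k.+1 / 2 <=
   avg (fun S => avg (fun T : {ffun 'I_k.+1 -> W} =>
     (good S && [forall i, T i \in nb S])%:R * Q T)).
  apply: le_trans (ler_avg step1).
  rewrite (eq_avg (g := fun S => 2^-1 * (n^-1 * d S) ^+ k.+1)); last first.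
    by move=> S; rewrite mulrC [d S / n]mulrC.
  rewrite avgZ mulrC ler_wpM2l ?invr_ge0 //.
  apply: le_trans (avg_pow _ _ _); last 2 first.
  - exact: card_ffun_gt0.
  - by move=> S; rewrite mulr_ge0 ?invr_ge0 // ltW.
  rewrite avgZ [w / n]mulrC; apply: lerXn2r.
  - by rewrite nnegrE mulr_ge0 ?invr_ge0 ?(ltW n0).
  - by rewrite nnegrE mulr_ge0 ?invr_ge0 ?(ltW n0) ?avg_ge0.
  by rewrite ler_wpM2l ?invr_ge0 ?(ltW n0).
(* For fixed [T], a counted [S] is an injective [k]-tuple in [common T]; this forces
   [k <= #|common T|] and bounds the density of such [S]. *)
apply: le_trans step2 _; rewrite avg_exchange mulrC -avgZ; apply: ler_avg => T.
have sub (S : {ffun 'I_k -> W}) : good S && [forall i, T i \in nb S] ->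
    injective S /\ forall j, S j \in common T.
  case/andP => /andP[/injectiveP Si _] /forallP H; split=> // j.
  rewrite inE; apply/forallP => i.
  by have := H i; rewrite inE => /forallP.
rewrite /Q; case: ltnP => cK; last first.
  rewrite (eq_avg (g := fun=> 0)) => [|S]; last by rewrite mulr0.
  by rewrite avg_cst ?card_ffun_gt0 // andbF mulr0.
rewrite andbT; case: leqP => kc; last first.
  rewrite (eq_avg (g := fun=> 0)) => [|S].
    by rewrite avg_cst ?card_ffun_gt0 // mulr0.
  rewrite mulr1; case: (boolP (_ && _)) => // /sub[Si Sc].
  move: kc; rewrite ltnNge => /negP[].
  rewrite -[X in (X <= _)%N]card_ord -(card_imset _ Si) subset_leq_card //.
  by apply/fintype.subsetP => _ /imsetP[j _ ->].
rewrite mulr1.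
apply: (@le_trans _ _ (avg (fun S : {ffun 'I_k -> W} =>
    [forall j, S j \in common T]%:R : R))).
  apply: ler_avg => S; rewrite mulr1 ler_nat; case: (boolP (_ && _)) => // /sub[_ Sc].
  by case: forallP.
rewrite avg_ffun_in card_ord lerXn2r ?nnegrE ?divr_ge0 ?(ltW n0) //.
by rewrite ler_wpM2r ?invr_ge0 ?(ltW n0) // ler_nat ltnW.
Qed.

End CommonNeighbourhoods.

(** * Choice of parameters *)

Section HubThreshold.

Variables (R : realFieldType) (W : finType) (adj : rel W) (q : R) (k s L A : nat).
Hypothesis adj_sym : symmetric adj.
Hypothesis adj_irr : irreflexive adj.

(* With [n = q ^ (t L)] the critical density [n ^ (-1/t - mu)], [mu = 1/(t L)],
   is [q ^ - L.+1], so that only integral powers of [q] are needed. Vertices of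
   degree above [n / q ^ A] are called hubs. *)
Let t := k.+1.
Let P := (s.+2 ^ t)%N.
Let M := (t * s.+2)%N.
Let K := (P * k + M)%N.

Hypothesis k0 : (0 < k)%N.
Hypothesis q1 : 1 <= q.
Hypothesis cardW : #|W|%:R = q ^+ (t * L).

Let q0 : 0 < q. Proof. exact: lt_le_trans ltr01 q1. Qed.
Let qn0 m : 0 < q ^+ m. Proof. exact: exprn_gt0. Qed.
Let W0 : (0 < #|W|)%N. Proof. by rewrite -(ltr0n R) cardW. Qed.

(** The main term [#|W| * d ^ M] is at least [q ^ L.+2], because [d >= q ^ - A] and
    [A * M + 2 <= L]. The error terms are at most a constant times [q ^ L.+1], because [B] is
    large. *)
Lemma subdivided_box_of_hubs (B : {set W}) :
  (A * M + 2 <= L)%N -> (2 * (M * M) + K)%:R < q ->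
  (forall x, x \in B -> 1 <= q ^+ A * avg (fun z => (adj x z)%:R : R)) ->
  1 <= 2 * q ^+ L.+1 * avg (fun x => (x \in B)%:R * avg (fun z => (adj x z)%:R : R)) ->
  subdivided_box adj t s.+2 k.
Proof.
move=> LA qbig hub many.
have B0 : (0 < #|B|)%N.
  rewrite lt0n; apply/negP => /eqP/card0_eq B0; move: many.
  rewrite (eq_avg (g := fun=> 0)) => [|x]; last by rewrite B0 mul0r.
  by rewrite avg_cst // mulr0 ler10.
have BW : q ^+ (t * L) <= 2 * q ^+ L.+1 * #|B|%:R.
  have : 1 <= 2 * q ^+ L.+1 * (#|B|%:R / #|W|%:R).
    apply: le_trans many _; rewrite ler_wpM2l ?mulr_ge0 ?(ltW (qn0 _)) //.
    rewrite -avg_set; apply: ler_avg => x; case: (x \in B); rewrite ?mul0r // mul1r.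
    rewrite -[leRHS](@avg_cst _ W) //; apply: ler_avg => z.
    by case: adj.
  by rewrite mulrA ler_pdivlMr ?ltr0n // mul1r cardW.
have cB : #|{: {x | x \in B}}| = #|B| by rewrite card_sig.
apply: (@subdivided_box_of_dense_part R {x | x \in B} W val adj t s.+2 k).
- exact: val_inj.
- by rewrite cB.
- exact: W0.
rewrite cB -/M -/P -/K.
set d := avg _.
have dA : 1 <= q ^+ A * d.
  rewrite -avgZ -[leLHS](@avg_cst R {x | x \in B}) ?cB //.
  by apply: ler_avg => x; apply: hub; exact: valP.
have dM : 1 <= q ^+ (A * M) * d ^+ M.
  by rewrite exprM -exprMn; exact: exprn_ege1.
have d0 : 0 <= d ^+ M.
  by rewrite exprn_ge0 // avg_ge0 // => x; apply: avg_ge0.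
have tL : (A * M + L.+2 <= t * L)%N by rewrite /t; nia.
have B0' : 0 < #|B|%:R :> R by rewrite ltr0n.
have W1 : #|W|%:R / #|B|%:R <= 2 * q ^+ L.+1.
  by rewrite ler_pdivrMr // cardW.
have W2 : q * q ^+ L.+1 <= #|W|%:R * d ^+ M.
  rewrite -exprS cardW; apply: (@le_trans _ _ (q ^+ (L.+2 + A * M) * d ^+ M)).
    rewrite exprD -mulrA -[leLHS]mulr1 ler_wpM2l // ltW //.
  by rewrite ler_wpM2r // ler_weXn2l // addnC.
apply: lt_le_trans W2.
have -> : #|W|%:R * ((M * M)%:R / #|B|%:R) = (M * M)%:R * (#|W|%:R / #|B|%:R) :> R.
  by rewrite mulrCA.
have q1' : 1 <= q ^+ L.+1 by exact: exprn_ege1.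
apply: (@le_lt_trans _ _ ((2 * (M * M) + K)%:R * q ^+ L.+1)); last first.
  by rewrite ltr_pM2r.
have -> : (2 * (M * M) + K)%:R = 2 * (M * M)%:R + K%:R :> R.
  by rewrite natrD [in LHS]natrM.
rewrite [leRHS]mulrDl; apply: lerD.
  by rewrite [2 * _]mulrC -mulrA ler_wpM2l.
by rewrite -[leLHS]mulr1 ler_wpM2l.
Qed.

Variable r : rel W.
Hypothesis r_adj : subrel r adj.
Hypothesis degr :
  forall x z, r x z -> q ^+ A * #|[set z | adj x z]|%:R <= q ^+ (t * L).

(** [Th] is the least size with [P * M * t / Th < 2 ^ - P], as the popular case requires. [C]
    collects the constants in the lower bound [1 / (C * q ^ (k * t))] on the density of unpopular
    tuples. *)
Let Th := (P * M * t * 2 ^ P + 1)%N.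
Let C := (2 ^ (k.+1 * t + 1) * K ^ k)%N.

(** Either some large [D] has more than half of its tuples popular, or [avg_unpopular] applies; then
    [A > t * k * P] makes the degree bound beat the [P]-th power of the density of unpopular
    tuples. *)
Lemma subdivided_box_of_bounded_degree :
  (k < L)%N -> (t * k * P < A <= t * L)%N ->
  (2 ^ k.+1 * (k * k + Th))%:R <= q -> (2 * (P * M * K) * C ^ P)%:R < q ->
  1 <= 2 * q ^+ L.+1 * avg (fun x => avg (fun z => (r x z)%:R : R)) ->
  subdivided_box adj t s.+2 k.
Proof.
move=> kL /andP[tkA AL] q2 q3 many.
have P0 : (0 < P)%N by rewrite expn_gt0.
have K0 : (0 < K)%N by rewrite addn_gt0 muln_gt0 P0 k0.
pose popular (D : {set W}) : R := avg (fun T : {ffun 'I_t -> {x | x \in D}} =>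
      (K <= #|common r [ffun i => val (T i)]|)%N%:R : R).
case: (boolP [exists D : {set W}, (Th <= #|D|)%N && (2^-1 < popular D)]).
  case/existsP => D /andP[ThD popD].
  have D0 : (0 < #|D|)%N by rewrite (leq_trans _ ThD) // /Th addn1.
  apply: (subdivided_box_of_popular (R := R) adj_sym r_adj D0).
  apply: (@lt_le_trans _ _ (2^-1 ^+ P)); last first.
    by rewrite lerXn2r ?nnegrE ?invr_ge0 ?(ltW popD) // avg_ge0.
  rewrite exprVn -/P -/M mulrA ltr_pdivrMr ?ltr0n // ltr_pdivlMl ?exprn_gt0 //.
  apply: lt_le_trans (_ : Th%:R <= _); last by rewrite ler_nat.
  by rewrite -natrX -!natrM ltr_nat /Th addn1 ltnS mulnC.
rewrite negb_exists => /forallP unpop.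
set p := avg _ in many.
(* With [t = k.+1] one has [t * L - L.+1 * k = L - k], so the codegree bound for [k]-tuples is still
   a positive power of [q]. *)
have pk : q ^+ (L - k) <= 2 ^+ k * (#|W|%:R * p ^+ k).
  have e : q ^+ (t * L) = q ^+ (L - k) * q ^+ (L.+1 * k).
    by rewrite -exprD /t; congr (_ ^+ _); nia.
  have := ler_wpM2l (ltW (qn0 (L - k))) (exprn_ege1 k many).
  rewrite mulr1 cardW e !exprMn -exprM => /le_trans; apply.
  by rewrite le_eqVlt; apply/orP; left; apply/eqP; ring.
have n0 : 0 < #|W|%:R :> R by rewrite ltr0n.
(* Half of the bound in [pk]; the other half absorbs [k * k + Th]. *)
pose w : R := q ^+ (L - k) / 2 ^+ k.+1.
have w0 : 0 <= w by rewrite divr_ge0 ?exprn_ge0 ?(ltW q0).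
have q1' : q <= q ^+ (L - k).
  by rewrite -[leLHS]expr1 ler_weXn2l // subn_gt0.
have wle : w + (k * k)%:R + Th%:R <= #|W|%:R * p ^+ k.
  have h2 : 0 < 2 ^+ k :> R by exact: exprn_gt0.
  have : 2 * 2 ^+ k * ((k * k)%:R + Th%:R) <= q ^+ (L - k).
    by apply: le_trans q1'; move: q2; rewrite natrM natrX exprS natrD.
  set X := _ + Th%:R => YX; rewrite -addrA -/X /w exprS.
  have hh : 0 < 2 * 2 ^+ k :> R by rewrite mulr_gt0.
  have X1 : X <= q ^+ (L - k) / (2 * 2 ^+ k) by rewrite ler_pdivlMr // mulrC.
  have X2 : q ^+ (L - k) / 2 ^+ k <= #|W|%:R * p ^+ k by rewrite ler_pdivrMr // mulrC.
  have X3 : q ^+ (L - k) / 2 ^+ k = 2 * (q ^+ (L - k) / (2 * 2 ^+ k)).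
    by rewrite invfM mulrCA [2 * (_ * _)]mulrA divff ?mul1r // pnatr_eq0.
  by lra.
have Th0 : (0 < Th)%N by rewrite /Th addn1.
have {}unpop (D : {set W}) : (Th <= #|D|)%N -> popular D <= 2^-1.
  by move=> ThD; have := unpop D; rewrite ThD /= -leNgt.
have := avg_unpopular W0 Th0 w0 wle unpop; set a := avg _ => aw.
apply: (@subdivided_box_of_unpopular R W adj r adj_sym adj_irr r_adj t s k K
  (#|W|%:R / q ^+ A)) => //.
- by rewrite divr_ge0 // ltW.
- by move=> x z /degr; rewrite cardW ler_pdivlMr // mulrC.
rewrite -/a -/P -/M.
have a0 : 0 <= a by rewrite avg_ge0.
have qa : 1 <= C%:R * q ^+ (k * t) * a.
  have : w ^+ t <= 2 * K%:R ^+ k * #|W|%:R * a.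
    have := ler_wpM2l (ltW (exprn_gt0 t n0)) aw.
    rewrite !expr_div_n mulrA mulrCA divff ?expf_neq0 ?gt_eqF // mulr1.
    rewrite ler_pdivrMr // => /le_trans; apply.
    rewrite [in leLHS]/t exprS le_eqVlt; apply/orP; left; apply/eqP.
    by field; rewrite expf_neq0 // gt_eqF.
  rewrite /w expr_div_n -!exprM ler_pdivrMr ?exprn_gt0 // cardW.
  have -> : (t * L = (L - k) * t + k * t)%N by rewrite /t; nia.
  rewrite -(ler_pM2l (qn0 ((L - k) * t))) mulr1 => /le_trans; apply.
  rewrite /C natrM !natrX !exprD expr1 le_eqVlt; apply/orP; left; apply/eqP.
  by ring.
have qaP : 1 <= C%:R ^+ P * q ^+ (k * t * P) * a ^+ P.
  by rewrite [q ^+ (_ * P)]exprM -!exprMn; exact: exprn_ege1.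
have aP0 : 0 < a ^+ P.
  rewrite lt0r exprn_ge0 // andbT; apply/eqP => z; move: qaP.
  by rewrite z mulr0 ler10.
rewrite -(ltr_pM2r (qn0 A)).
(* After multiplication by [q ^+ A] the left side is at most this constant, as [q ^+ A <= #|W|],
   while the right side has a factor [q] to spare. *)
apply: (@le_lt_trans _ _ (2 * (P * M * K))%:R).
  have -> : (P * M)%:R * (K%:R * (#|W|%:R / q ^+ A + 1) / #|W|%:R) * q ^+ A
      = (P * M * K)%:R * (1 + q ^+ A / #|W|%:R) :> R.
    by rewrite !natrM; field; rewrite !gt_eqF.
  rewrite [(2 * _)%N]mulnC [in leRHS]natrM ler_wpM2l // -[2%:R]/(1 + 1) lerD2l.
  rewrite ler_pdivrMr // mul1r.
  by rewrite cardW ler_weXn2l.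
apply: (@le_lt_trans _ _ ((2 * (P * M * K))%:R *
    (C%:R ^+ P * q ^+ (k * t * P) * a ^+ P))).
  by rewrite -[leLHS]mulr1 ler_wpM2l.
apply: (@lt_le_trans _ _ (q * (q ^+ (k * t * P) * a ^+ P))).
  by rewrite -!mulrA mulrA ltr_pM2r ?mulr_gt0 // -natrX -natrM.
rewrite mulrA -exprS mulrC ler_wpM2l ?(ltW aP0) // ler_weXn2l //.
by rewrite [(k * t)%N]mulnC.
Qed.

End HubThreshold.

(** The constants are fixed in the order [A], [L], [Q]: [A] beats the exponent [k.+1 * k * P] lost
    in the bounded degree case, [L] beats the loss [A * M] of the hub case, and [Q] exceeds the
    three lower bounds on [q]. *)
Lemma subdivided_box_threshold (R : realFieldType) (k s : nat) : (0 < k)%N ->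
  exists L Q : nat, (0 < L)%N /\
    forall (W : finType) (adj : rel W) (q : R), symmetric adj -> irreflexive adj ->
      Q%:R <= q -> #|W|%:R = q ^+ (k.+1 * L) ->
      1 <= q ^+ L.+1 * avg (fun x => avg (fun z => (adj x z)%:R : R)) ->
      subdivided_box adj k.+1 s.+2 k.
Proof.
move=> k0; pose P := (s.+2 ^ k.+1)%N; pose M := (k.+1 * s.+2)%N.
pose K := (P * k + M)%N; pose A := (k.+1 * k * P + 1)%N.
pose L := (A * M + 2 + k.+1 + A)%N.
pose a1 := (2 * (M * M) + K)%N.
pose a2 := (2 ^ k.+1 * (k * k + (P * M * k.+1 * 2 ^ P + 1)))%N.
pose a3 := (2 * (P * M * K) * (2 ^ (k.+1 * k.+1 + 1) * K ^ k) ^ P)%N.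
have LA : (A * M + 2 <= L)%N := leq_trans (leq_addr k.+1 _) (leq_addr A _).
have kL : (k < L)%N := leq_trans (leq_addl _ _) (leq_addr A _).
have AL : (A <= k.+1 * L)%N := leq_trans (leq_addl _ A) (leq_pmull L (ltn0Sn k)).
exists L, (a1 + a2 + a3 + 1)%N; split; first exact: leq_ltn_trans kL.
move=> W adj q adjC adj0 Qq cW many.
have qa (a : nat) : (a < a1 + a2 + a3 + 1)%N -> a%:R < q.
  by move=> h; apply: lt_le_trans Qq; rewrite ltr_nat.
have q1 : 1 <= q by apply: le_trans Qq; rewrite ler1n addn1.
have W0 : (0 < #|W|)%N.
  by rewrite -(ltr0n R) cW exprn_gt0 // (lt_le_trans ltr01).
pose B := [set x | q ^+ (k.+1 * L) < q ^+ A * #|[set z | adj x z]|%:R].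
pose r x z := adj x z && (x \notin B).
have rC : subrel r adj by move=> x z /andP[].
(* Adjacent pairs are split by whether [x] is a hub; one of the two parts keeps half of the
   density. *)
have split_avg : avg (fun x => avg (fun z => (adj x z)%:R : R)) =
    avg (fun x => (x \in B)%:R * avg (fun z => (adj x z)%:R)) +
    avg (fun x => avg (fun z => (r x z)%:R)).
  rewrite -avgD; apply: eq_avg => x; rewrite -avgZ -avgD; apply: eq_avg => z.
  by rewrite /r; case: (x \in B); rewrite ?andbF ?andbT ?mul1r ?mul0r ?addr0 ?add0r.
rewrite split_avg mulrDr in many.
set p1 := avg (fun x => (x \in B)%:R * _) in many.
set p2 := avg (fun x => avg (fun z => (r x z)%:R)) in many.
have [h|h] := leP 1 (2 * q ^+ L.+1 * p1).
  apply: (@subdivided_box_of_hubs R W adj q k s L A k0 q1 cW B) => //.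
  - by apply: (qa a1); rewrite addn1 ltnS -addnA leq_addr.
  move=> x; rewrite inE -cW => xB.
  rewrite (eq_avg (g := fun z => (z \in [set z | adj x z])%:R)); last first.
    by move=> z; rewrite inE.
  by rewrite avg_set mulrA ler_pdivlMr ?ltr0n // mul1r ltW.
apply: (@subdivided_box_of_bounded_degree R W adj q k s L A adjC adj0 k0 q1 cW r rC).
- move=> x z /andP[_]; rewrite inE -leNgt; exact.
- exact: kL.
- by rewrite AL andbT /A addn1.
- by apply/ltW/(qa a2); rewrite addn1 ltnS addnAC leq_addl.
- by apply: (qa a3); rewrite addn1 ltnS leq_addl.
- rewrite -/p2 -mulrA; move: h many; rewrite -mulrA.
  by lra.
Qed.

(** * From edge counts to the extremal number *)

(** The map from ordered pairs to unordered ones covers all edges; the factor two lost here is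
    harmless. *)
Lemma edge_density (R : realFieldType) (W : finType) (G : {set {set W}}) :
  uniform 2 G ->
  #|G|%:R / #|W|%:R ^+ 2 <=
    avg (fun x => avg (fun z => ([set x; z] \in G)%:R : R)).
Proof.
move=> /forall_inP G2.
rewrite /avg -mulr_suml -mulrA -invfM -expr2 ler_wpM2r ?invr_ge0 ?exprn_ge0 //.
rewrite pair_big /= (eq_bigr
  (fun p => (p \in [set p : W * W | [set p.1; p.2] \in G])%:R)); last first.
  by move=> p _; rewrite inE.
rewrite -natr_sum ler_nat.
rewrite (eq_bigr
  (fun p => if p \in [set p : W * W | [set p.1; p.2] \in G] then 1%N else 0%N)); last first.
  by move=> p _; case: (p \in _).
rewrite -big_mkcond sum1_card.
apply: leq_trans (leq_imset_card (fun p : W * W => [set p.1; p.2]) _).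
rewrite subset_leq_card //; apply/fintype.subsetP => e eG.
have /cards2P[x [z [_ exz]]] := G2 e eG.
by apply/imsetP; exists (x, z); rewrite ?inE /= -?exz.
Qed.

Local Open Scope classical_set_scope.

Theorem theorem3p1 (R : realType) (t : nat) (V : finType) (H : {set {set V}}) :
  (2 <= t)%N -> uniform t H -> partite t H ->
  exists2 mu : R, 0 < mu &
    (fun n : nat => (ex n (subdivision t.-1 H))%:R : R^o) =O_\oo
    (fun n : nat => n%:R `^ (2 - t%:R^-1 - mu) : R^o).
Proof.
case: t => [|k] //; rewrite ltnS => k0 _ partH.
have [L [Q [L0 box]]] := subdivided_box_threshold R #|V| k0.
pose mu : R := (k.+1 * L)%:R^-1.
have mu0 : 0 < mu by rewrite invr_gt0 ltr0n muln_gt0.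
exists mu => //; apply/eqO_exP; exists 1 => //.
(* From this [n] on, [q = n ^ mu] is at least [Q], and the bound holds with constant [1]. *)
exists ((Q ^ (k.+1 * L)).+1) => // n /= Qn.
rewrite mul1r !ger0_norm ?powR_ge0 //.
rewrite /ex; apply: (big_ind (fun m : nat => m%:R <= n%:R `^ (2 - k.+1%:R^-1 - mu))).
- exact: powR_ge0.
- by move=> a b ha hb; case: (leqP a b).
move=> G /andP[G2 free]; rewrite leNgt; apply: contra free => big.
apply: (@subdivided_box_contains _ #|V|.+1 _ _ _ _ _ partH); first by rewrite !leqW.
have n0 : (0 < n)%N by exact: leq_ltn_trans Qn.
have n0R : 0 < n%:R :> R by rewrite ltr0n.
pose q : R := n%:R `^ mu.
have qE m : q ^+ m = n%:R `^ (mu * m%:R) by rewrite powRrM powR_mulrn ?powR_ge0.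
have qn : q ^+ (k.+1 * L) = n%:R.
  by rewrite qE mulVf ?powRr1 // pnatr_eq0 -lt0n muln_gt0.
apply: (box _ _ q).
- by move=> x z; rewrite finset.setUC.
- move=> x; apply/negP => /(forall_inP G2); rewrite finset.setUid cards1.
  by [].
- rewrite leNgt; apply/negP => qQ; have : q ^+ (k.+1 * L) <= Q%:R ^+ (k.+1 * L).
    by rewrite lerXn2r ?nnegrE ?powR_ge0 // ltW.
  by rewrite qn -natrX ler_nat leqNgt Qn.
- by rewrite card_ord qn.
apply: le_trans (ler_wpM2l _ (edge_density R G2)); last first.
  by rewrite exprn_ge0 ?powR_ge0.
rewrite card_ord mulrA ler_pdivlMr ?exprn_gt0 // mul1r qE.
(* The exponents add up to [2] because [mu * L = 1 / k.+1]. *)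
have -> : n%:R ^+ 2 = n%:R `^ (2 - k.+1%:R^-1 - mu) * n%:R `^ (mu * L.+1%:R) :> R.
  rewrite -powRD; last by rewrite (gt_eqF n0R) implybT.
  rewrite -powR_mulrn //; congr (_ `^ _).
  have -> : mu * L.+1%:R = k.+1%:R^-1 + mu.
    by rewrite -natr1 mulrDr mulr1 /mu natrM invfM divfK // pnatr_eq0 -lt0n.
  by ring.
by rewrite mulrC ler_wpM2l ?powR_ge0 // ltW.
Qed.
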